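(* The category of all well-filtered spaces (with continuous mappings) is reflexive in the category of all $T_0$ spaces (with continuous mappings); that is, the full subcategory of well-filtered spaces is a reflective subcategory of the category of $T_0$ spaces.
   Context: For a topological space $X$ and $A\subseteq X$, the saturation of $A$ is $sat(A)=\bigcap\{U : U \text{ open in } X,\ A\subseteq U\}$, and $A$ is saturated if $A=sat(A)$. Compact means every open cover has a finite subcover (no separation axiom is assumed). A nonempty family $\mathcal F$ of saturated compact subsets of $X$ is filtered if for any $F_1,F_2\in\mathcal F$ there is $F_3\in\mathcal F$ with $F_3\subseteq F_1\cap F_2$. A $T_0$ space $X$ is well-filtered if for every open set $U\subseteq X$ and every filtered family $\mathcal F$ of saturated compact subsets of $X$, $\bigcap\mathcal F\subseteq U$ implies $F\subseteq U$ for some $F\in\mathcal F$. ''Reflexive'' is used in the sense of ''reflective'': the inclusion functor has a left adjoint. *)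

(* Defs.v *)
From HB Require Import structures.
From mathcomp Require Import all_boot all_classical.
From mathcomp Require Import topology.

Set Implicit Arguments.
Unset Strict Implicit.
Unset Printing Implicit Defensive.

Local Open Scope classical_set_scope.

Section WellFiltered.
Context {X : topologicalType}.
Implicit Types (A K U : set X) (F : set (set X)).

Definition saturation A : set X :=
  \bigcap_(U in [set U | open U /\ A `<=` U]) U.

Definition saturated A := A = saturation A.

(* [cover_compact] is compactness by open covers (no separation axiom);
   [compact_cover] identifies it with the library's cluster-point [compact]. *)
Definition filtered_family F :=
  [/\ F !=set0,
      forall K, F K -> saturated K /\ cover_compact K
    & forall K1 K2, F K1 -> F K2 -> exists2 K3, F K3 & K3 `<=` K1 `&` K2].

End WellFiltered.

(* The T0 axiom is not included: it is carried by the objects of [T0] below. *)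
Definition well_filtered (X : topologicalType) :=
  forall (U : set X) (F : set (set X)), open U -> filtered_family F ->
    \bigcap_(K in F) K `<=` U -> exists2 K, F K & K `<=` U.

Record category := Category {
  obj :> Type;
  hom : obj -> obj -> Type;
  idm : forall X, hom X X;
  compm : forall X Y Z, hom Y Z -> hom X Y -> hom X Z;
  compm1 : forall X Y (f : hom X Y), compm f (idm X) = f;
  comp1m : forall X Y (f : hom X Y), compm (idm Y) f = f;
  compmA : forall X Y Z T (h : hom Z T) (g : hom Y Z) (f : hom X Y),
    compm h (compm g f) = compm (compm h g) f
}.

Arguments hom {c} X Y.
Arguments idm {c} X.
Arguments compm {c X Y Z} g f.

Notation "g '\oc' f" := (compm g f) (at level 40, left associativity).

Record functor (C D : category) := Functor {
  fobj :> C -> D;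
  fmap : forall X Y, hom X Y -> hom (fobj X) (fobj Y);
  fmap1 : forall X, fmap (idm X) = idm (fobj X);
  fmapM : forall X Y Z (g : hom Y Z) (f : hom X Y),
    fmap (g \oc f) = fmap g \oc fmap f
}.

Arguments fmap {C D} F {X Y} f : rename.

(* [L] is left adjoint to [G]: bijections [hom (L X) Y -> hom X (G Y)]
   natural in both [X] and [Y]. *)
Definition left_adjoint (C D : category) (L : functor C D) (G : functor D C) :=
  exists phi : forall (X : C) (Y : D), hom (L X) Y -> hom X (G Y),
    (forall X Y, bijective (phi X Y)) /\
    (forall (X X' : C) (Y Y' : D)
        (f : hom X' X) (g : hom Y Y') (h : hom (L X) Y),
      phi X' Y' (g \oc h \oc fmap L f) = fmap G g \oc phi X Y h \oc f).

Definition full_subcategory (C : category) (P : C -> Prop) : category :=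
  {| obj := {X : C | P X};
     hom := fun X Y => hom (sval X) (sval Y);
     idm := fun X => idm (sval X);
     compm := fun X Y Z g f => g \oc f;
     compm1 := fun X Y f => compm1 f;
     comp1m := fun X Y f => comp1m f;
     compmA := fun X Y Z T h g f => compmA h g f |}.

Definition inclusion (C : category) (P : C -> Prop) :
    functor (full_subcategory P) C :=
  {| fobj := fun X : full_subcategory P => sval X;
     fmap := fun X Y f => f;
     fmap1 := fun X => erefl;
     fmapM := fun X Y Z g f => erefl |}.

Definition reflective (C : category) (P : C -> Prop) :=
  exists L : functor C (full_subcategory P), left_adjoint L (inclusion P).

Program Definition Top : category :=
  {| obj := topologicalType;
     hom := fun X Y => continuousType X Y;
     idm := fun X => idfun : continuousType X X;
     compm := fun X Y Z g f => (g \o f) : continuousType X Z |}.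
Next Obligation. by move=> X Y f; apply/continuousEP. Qed.
Next Obligation. by move=> X Y f; apply/continuousEP. Qed.
Next Obligation. by move=> X Y Z T h g f; apply/continuousEP. Qed.

Definition T0 : category := full_subcategory (C := Top) kolmogorov_space.

Definition T0_space (X : T0) : topologicalType := sval X.

(* Main.v *)
From HB Require Import structures.
From mathcomp Require Import all_boot all_classical.
From mathcomp Require Import finmap topology.
Require Import Defs.

(** The reflection of a space X is the space of its well-filtered determined
    closed irreducible subsets, and its points are characterised by generic
    points.  Say that y is generic for the image of A under f : X -> Y when an
    open V contains y exactly when f maps some point of A into V; equivalently,
    the closure of f(A) is the closure of y.  A set A is well-filtered
    determined when every continuous map from X to a well-filtered T0 space has
    a generic point for the image of A.  Call X^w the set of closed irreducible
    well-filtered determined subsets of X, with open sets the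
    hat O = {a | a meets O} for O open in X, and eta x the closure of x.

    The universal property is formal.  A map f from X to a well-filtered T0
    space Y extends to X^w by sending a to the generic point of f(a)
    ([wd_ext]), and the extension is unique because a is itself generic for
    eta(a) ([wd_eta_generic]).

    The content is that X^w is well-filtered ([wd_space_well_filtered]).  Let F
    be a filtered family of compact saturated sets, none contained in the open
    set U.  By Zorn's lemma there is a maximal open W containing U and
    no member of F ([exists_maximal_avoiding]); its complement C is a minimal
    closed set meeting all members of F, which is the topological form of
    Rudin's lemma.  Minimality makes C irreducible
    ([maximal_avoiding_irreducible]).  It also gives, for every continuous g
    into a well-filtered space, a generic point for g(C)
    ([maximal_avoiding_generic]): any point common to the closure of g(C) and
    to all the saturations of g(K `&` C), K in F, will do.  Applied to
    extensions of maps out of X, this shows that the preimage of C under eta is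
    a point a of X^w.  That point is generic for C, hence lies in every member
    of F and outside W, so the intersection of F is not contained in U. *)

Set Implicit Arguments.
Unset Strict Implicit.
Unset Printing Implicit Defensive.

Local Open Scope classical_set_scope.

(** * Saturation and compactness *)

Section Saturation.
Context {X : topologicalType}.
Implicit Types (A K U : set X) (G : set (set X)).

Lemma subset_saturation A : A `<=` saturation A.
Proof. by move=> x Ax U [_ AU]; exact: AU. Qed.

Lemma saturation_sub A U : open U -> A `<=` U -> saturation A `<=` U.
Proof. by move=> oU AU x sAx; exact: sAx. Qed.

Lemma saturationS A B : A `<=` B -> saturation A `<=` saturation B.
Proof.
by move=> AB x sAx U [oU BU]; apply: sAx; split=> //; exact: subset_trans BU.
Qed.

Lemma saturated_saturation A : saturated (saturation A).
Proof.
rewrite /saturated eqEsubset; split; first exact: subset_saturation.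
move=> x ssAx U [oU AU]; apply: ssAx; split => //.
exact: saturation_sub.
Qed.

Lemma cover_compact_saturation A : cover_compact A ->
  cover_compact (saturation A).
Proof.
move=> cA I D f oD sD.
have [|D' D'D AD'] := cA I D f oD.
  by apply: subset_trans sD; exact: subset_saturation.
exists D' => //; apply: saturation_sub => //.
by apply: bigcup_open => i /D'D /set_mem; exact: oD.
Qed.

Lemma cover_compact_directed K G : cover_compact K -> G !=set0 ->
  (forall U, G U -> open U) ->
  (forall U V, G U -> G V -> exists2 W, G W & U `|` V `<=` W) ->
  K `<=` \bigcup_(U in G) U -> exists2 U, G U & K `<=` U.
Proof.
move=> cK [U0 GU0] oG dG KG.
have [D' D'G KD'] := cK _ G id oG KG.
suff [W GW D'W] : exists2 W, G W & forall U, U \in (D' : seq _) -> U `<=` W.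
  by exists W => //; apply: subset_trans KD' _ => x [U /= UD']; exact: D'W.
have {D'G KD'} : {in (D' : seq _), forall U, G U} by move=> U /D'G /set_mem.
elim: (D' : seq _) => [_|U s IH sG]; first by exists U0.
have [V Us|V GV sV] := IH; first by apply: sG; rewrite inE Us orbT.
have [|W GW UVW] := dG U V _ GV; first by apply: sG; rewrite mem_head.
exists W => // T; rewrite inE => /predU1P[->|/sV TV] x Tx; apply: UVW.
  by left.
by right; exact: TV.
Qed.

End Saturation.

Lemma cover_compact_image (X Y : topologicalType) (f : X -> Y) (K : set X) :
  continuous f -> cover_compact K -> cover_compact (f @` K).
Proof.
move=> /continuousP cf cK I D h oD hK.
have [||D' D'D KD'] := cK I D (fun i => f @^-1` h i).
- by move=> i Di; exact/cf/oD.
- by move=> x Kx; apply: hK; exists x.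
by exists D' => // _ [x /KD' hx <-].
Qed.

Lemma cover_compact_setD (X : topologicalType) (K W : set X) :
  open W -> cover_compact K -> cover_compact (K `\` W).
Proof.
move=> oW cK I D f oD fK.
have [->|/set0P[x0 /fK[i0 Di0 _]]] := eqVneq (K `\` W) set0.
  by exists fset0.
have [||D' D'D KD'] := cK I D (fun i => W `|` f i).
- by move=> i Di; apply: openU => //; exact: oD.
- move=> x Kx; have [Wx|nWx] := pselect (W x).
    by exists i0 => //; left.
  by have [i Di fx] := fK x (conj Kx nWx); exists i => //; right.
by exists D' => // x [/KD'[i D'i [//|fx]] nWx]; exists i.
Qed.

(** * Irreducible sets and generic points *)

(** Nonempty, and any two open sets meeting [A] meet inside [A]. *)
Definition irreducible (X : topologicalType) (A : set X) :=
  A !=set0 /\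
  forall U V, open U -> open V -> A `&` U !=set0 -> A `&` V !=set0 ->
    A `&` (U `&` V) !=set0.

(** [y] is a generic point of the image of [A] under [f]: the closures of
    [f @` A] and of [y] are equal, expressed by the open sets they meet. *)
Definition generic_point (X Y : topologicalType) (A : set X) (f : X -> Y)
    (y : Y) :=
  forall V, open V -> V y <-> A `&` f @^-1` V !=set0.

(** In a T0 space, points with the same open neighbourhoods are equal. *)
Lemma kolmogorov_eq (X : topologicalType) (x y : X) : kolmogorov_space X ->
  (forall U, open U -> U x <-> U y) -> x = y.
Proof.
move=> T0X xy; apply: contrapT => /eqP /T0X [A].
move=> [] [/set_mem + /set_mem nA]; rewrite nbhsE => -[U [oU Ux] UA]; apply: nA.
  exact/UA/(xy U oU).
exact/UA/(xy U oU).
Qed.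

(** * Maximal open sets containing no member of a filtered family *)

Section MaximalAvoiding.
Context {X : topologicalType}.
Implicit Types (U V W K : set X) (F : set (set X)).

(** [W] is maximal among the open sets that contain no member of [F]; its
    complement is then a minimal closed set meeting all members of [F]. *)
Definition maximal_avoiding F W :=
  [/\ open W, forall K, F K -> ~ K `<=` W &
    forall V, open V -> (forall K, F K -> ~ K `<=` W `|` V) -> V `<=` W].

(** The topological form of Rudin's lemma. *)
Lemma exists_maximal_avoiding F U : (forall K, F K -> cover_compact K) ->
  open U -> (forall K, F K -> ~ K `<=` U) ->
  exists2 W, U `<=` W & maximal_avoiding F W.
Proof.
move=> cF oU FU.
pose P := [set V | open V /\ forall K, F K -> ~ K `<=` U `|` V].
have [G GP totG|V [[oV FV] maxV]] := @Zorn_bigcup X P.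
  have oG V : G V -> open V by move=> /GP[].
  split=> [|K FK KG]; first exact: bigcup_open.
  (* Compactness needs a nonempty directed family, and the chain may be empty,
     so the empty set is added to it. *)
  pose G' := [set U `|` V | V in set0 |` G].
  have [||_ _ [W1 GW1 <-] [W2 GW2 <-]||_ [V GV <-]] :=
    @cover_compact_directed _ K G' (cF K FK).
  - by exists (U `|` set0); exists set0; [left|].
  - by move=> _ [V [->|/oG oV] <-]; apply: openU => //; exact: open0.
  - have [W12|W21] : W1 `<=` W2 \/ W2 `<=` W1.
    + case: GW1 => [->|GW1]; first by left.
      by case: GW2 => [->|GW2]; [right|exact: totG].
    + exists (U `|` W2); first by exists W2.
      by rewrite subUset; split=> //; exact: setUS.
    + exists (U `|` W1); first by exists W1.
      by rewrite subUset; split=> //; exact: setUS.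
  - move=> x /KG[Ux|[V GV Vx]].
      by exists (U `|` set0); [exists set0; [left|]|left].
    by exists (U `|` V); [exists V; [right|]|right].
  - case: GV => [->|/GP[_ /(_ K FK)//]].
    by rewrite setU0; exact: FU.
exists (U `|` V); first exact: subsetUl.
split=> [||V' oV' FV']; [exact: openU|exact: FV|].
apply: contrapT => V'UV; apply: (maxV (V `|` V')).
  split=> [|VV']; first exact: subsetUl.
  apply: V'UV => x V'x; right.
  by apply: VV'; right.
split; first exact: openU.
by move=> K FK; rewrite setUA; exact: FV'.
Qed.

(** An open set meeting the complement of [W] covers, up to [W], some member of
    the family. *)
Lemma maximal_avoiding_meets F W V : maximal_avoiding F W -> open V ->
  ~` W `&` V !=set0 -> exists2 K, F K & K `<=` W `|` V.
Proof.
move=> [_ _ maxW] oV [x [nWx Vx]]; apply: contrapT => nFV; apply: nWx.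
by apply: (maxW V) => // K FK KV; apply: nFV; exists K.
Qed.

Lemma maximal_avoiding_irreducible F W : filtered_family F ->
  maximal_avoiding F W -> irreducible (~` W).
Proof.
move=> [[K0 FK0] _ dF] mW; have [_ FW _] := mW; split.
  by have [x [_ nWx]] := nonsubset (FW K0 FK0); exists x.
move=> U V oU oV /(maximal_avoiding_meets mW oU)[K1 FK1 K1U].
move=> /(maximal_avoiding_meets mW oV)[K2 FK2 K2V].
have [K FK K12] := dF _ _ FK1 FK2.
apply: contrapT => nUV; apply: (FW K FK) => x Kx; apply: contrapT => nWx.
apply: nUV; exists x; split=> //; have [/K1U + /K2V] := K12 x Kx.
by move=> [//|Ux] [//|Vx].
Qed.

Lemma maximal_avoiding_generic F W (Y : topologicalType) (g : X -> Y) :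
  filtered_family F -> maximal_avoiding F W ->
  well_filtered Y -> continuous g -> exists y, generic_point (~` W) g y.
Proof.
move=> [[K0 FK0] csF dF] mW wfY cg; have [oW FW _] := mW.
pose sg K := saturation (g @` (K `\` W)).
have ffG : filtered_family [set sg K | K in F].
  split; first by exists (sg K0), K0.
    move=> _ [K FK <-]; split; first exact: saturated_saturation.
    apply/cover_compact_saturation/cover_compact_image => //.
    by apply: cover_compact_setD => //; have [] := csF K FK.
  move=> _ _ [K1 FK1 <-] [K2 FK2 <-]; have [K FK K12] := dF _ _ FK1 FK2.
  exists (sg K); first by exists K.
  by rewrite subsetI; split; apply: saturationS; apply: image_subset;
    move=> x [/K12[]].
(* The complement of the closure of g(C), where C is the complement of W. *)
pose V0 := \bigcup_(V in [set V : set Y | open V /\ g @^-1` V `<=` W]) V.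
have oV0 : open V0 by apply: bigcup_open => V [].
(* Otherwise well-filteredness of Y would put some K inside W. *)
have [y sgy nV0y] : exists2 y, (forall K, F K -> sg K y) & ~ V0 y.
  apply: contrapT => ny; have [|_ [K FK <-] KV0] := wfY V0 _ oV0 ffG.
    move=> y sgy; apply: contrapT => nV0y; apply: ny; exists y => // K FK.
    by apply: sgy; exists K.
  apply: (FW K FK) => x Kx; apply: contrapT => nWx.
  have [V [_ VW] Vgx] : V0 (g x).
    by apply: KV0; apply: subset_saturation; exists x.
  exact/nWx/VW.
exists y => V oV; split=> [Vy|].
  apply: contrapT => nCV; apply: nV0y; exists V => //; split=> // x Vgx.
  by apply: contrapT => nWx; apply: nCV; exists x.
have ogV : open (g @^-1` V) by move/continuousP: cg; exact.
move=> /(maximal_avoiding_meets mW ogV)[K FK KWV].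
apply: (saturation_sub oV _ (sgy K FK)) => _ [x [Kx nWx] <-].
by have [] := KWV x Kx.
Qed.

End MaximalAvoiding.

(** * The space of well-filtered determined sets *)

(** Every continuous map to a well-filtered T0 space has a generic point for the
    image of [A].  The quantification ranges over all well-filtered T0 spaces in
    the universe of [X]; being propositional, it does not raise the universe of
    [wd_space X]. *)
Definition wf_determined (X : topologicalType) (A : set X) :=
  forall (Y : topologicalType) (f : X -> Y), kolmogorov_space Y ->
    well_filtered Y -> continuous f -> exists y, generic_point A f y.

(** The points of X^w. *)
Record wd_space (X : topologicalType) := WdSpace {
  wd_set :> set X;
  wd_closed : closed wd_set;
  wd_irreducible : irreducible wd_set;
  wd_determined : wf_determined wd_set
}.

Section WdSpace.
Context {X : topologicalType}.
Implicit Types (a b : wd_space X) (O : set X) (N : set (wd_space X)).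

HB.instance Definition _ := gen_eqMixin (wd_space X).
HB.instance Definition _ := gen_choiceMixin (wd_space X).

(** The open sets of X^w are exactly the sets [wd_hat O] with [O] open; they are
    closed under intersection because points of X^w are irreducible. *)
Definition wd_hat O : set (wd_space X) := [set a | (a : set X) `&` O !=set0].

Definition wd_open N := exists2 O, open O & N = wd_hat O.

Lemma wd_openT : wd_open setT.
Proof.
exists setT; first exact: openT.
apply/esym; rewrite -subTset => a _; rewrite /wd_hat /= setIT.
by have [] := wd_irreducible a.
Qed.

Lemma wd_openI : setI_closed wd_open.
Proof.
move=> _ _ [U oU ->] [V oV ->]; exists (U `&` V); first exact: openI.
rewrite eqEsubset; split=> a; first by case; apply: (wd_irreducible a).2.
by move=> [x [ax [Ux Vx]]]; split; exists x.
Qed.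

Lemma wd_open_bigU (I : Type) (N : I -> set (wd_space X)) :
  (forall i, wd_open (N i)) -> wd_open (\bigcup_i N i).
Proof.
move=> oN; exists (\bigcup_(O in [set O | open O /\ exists i, N i = wd_hat O]) O).
  by apply: bigcup_open => O [].
rewrite eqEsubset; split=> a.
  move=> [i _]; have [O oO NO] := oN i; rewrite NO => -[x [ax Ox]].
  by exists x; split=> //; exists O => //; split=> //; exists i.
move=> [x [ax [O [oO [i NO]] Ox]]]; exists i => //.
by rewrite NO; exists x.
Qed.

HB.instance Definition _ :=
  isOpenTopological.Build (wd_space X) wd_openT wd_openI wd_open_bigU.

Lemma closure1_meets (x : X) O : open O ->
  closure [set x] `&` O !=set0 <-> O x.
Proof.
move=> oO; split=> [[y [clxy Oy]]|Ox].
  by have [_ [->]] := clxy O (open_nbhs_nbhs (conj oO Oy)).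
by exists x; split=> //; exact: subset_closure.
Qed.

Lemma closure1_irreducible (x : X) : irreducible (closure [set x]).
Proof.
split; first by exists x; exact: subset_closure.
move=> U V oU oV /(closure1_meets x oU) Ux /(closure1_meets x oV) Vx.
exact/(closure1_meets x (openI oU oV)).
Qed.

Lemma closure1_determined (x : X) : wf_determined (closure [set x]).
Proof.
move=> Y f _ _ /continuousP cf; exists (f x) => V oV.
by apply: iff_sym; apply: closure1_meets; exact: cf.
Qed.

(** The unit of the reflection. *)
Definition wd_eta (x : X) : wd_space X :=
  WdSpace (@closed_closure _ [set x]) (closure1_irreducible x)
    (@closure1_determined x).

Lemma wd_hat_eta O (x : X) : open O -> wd_hat O (wd_eta x) <-> O x.
Proof. exact: closure1_meets. Qed.

Lemma wd_eta_continuous : continuous wd_eta.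
Proof.
apply/continuousP => _ [O oO ->].
suff -> : wd_eta @^-1` wd_hat O = O by [].
by apply/seteqP; split=> x /(wd_hat_eta x oO).
Qed.

(** Each point of X^w is generic for its own image under the unit, which
    therefore has dense range. *)
Lemma wd_eta_generic a : generic_point a wd_eta a.
Proof.
move=> _ [O oO ->]; split=> -[x [ax Ox]]; exists x; split=> //.
  exact/wd_hat_eta.
exact/(wd_hat_eta x oO).
Qed.

Lemma wd_space_T0 : kolmogorov_space (wd_space X).
Proof.
move=> a b ab.
have sub_eq (c d : wd_space X) :
    (forall O, open O -> wd_hat O c -> wd_hat O d) -> c `<=` d.
  move=> cd x cx; apply: contrapT => ndx.
  have [||y [dy]] := cd (~` d); last exact.
    exact/closed_openC/wd_closed.
  by exists x.
have nhat (c d : wd_space X) : ~ c `<=` d ->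
    exists A, A \in nbhs c /\ d \in ~` A.
  move=> ncd; apply: contrapT => nA; apply: ncd; apply: sub_eq => O oO cO.
  apply: contrapT => ndO; apply: nA; exists (wd_hat O); split; apply/mem_set => //.
  by apply: open_nbhs_nbhs; split=> //; exists O.
have [sab|/nhat[A ?]] := pselect (a `<=` b); last by exists A; left.
have [sba|/nhat[A ?]] := pselect (b `<=` a); last by exists A; right.
exfalso; move/eqP: ab; apply.
case: a b sab sba => [A cA iA dA] [B cB iB dB] /= sAB sBA.
have AB : A = B by apply/seteqP.
case: B / AB cB iB dB sAB sBA => cB iB dB _ _.
by congr WdSpace; exact: Prop_irrelevance.
Qed.

Section Extension.
Context {Y : topologicalType} (f : X -> Y).
Context (T0Y : kolmogorov_space Y) (wfY : well_filtered Y) (cf : continuous f).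

(** The extension to X^w of a map into a well-filtered T0 space; it sends a set
    to the generic point of its image. *)
Definition wd_ext a : Y := sval (cid (wd_determined a T0Y wfY cf)).

Lemma wd_extP a : generic_point a f (wd_ext a).
Proof. by rewrite /wd_ext; case: cid. Qed.

Lemma wd_ext_continuous : continuous wd_ext.
Proof.
apply/continuousP => V oV; exists (f @^-1` V).
  by move/continuousP: cf; exact.
by apply/seteqP; split=> a /(wd_extP a oV).
Qed.

Lemma wd_ext_eta x : wd_ext (wd_eta x) = f x.
Proof.
apply: (kolmogorov_eq T0Y) => V oV.
apply: (iff_trans (wd_extP _ oV)); apply: closure1_meets.
by move/continuousP: cf; exact.
Qed.

End Extension.

Lemma wd_ext_unique (Y : topologicalType) (g h : wd_space X -> Y) :
  kolmogorov_space Y -> continuous g -> continuous h ->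
  g \o wd_eta =1 h \o wd_eta -> g =1 h.
Proof.
move=> T0Y /continuousP cg /continuousP ch gh a.
apply: (kolmogorov_eq T0Y) => V oV.
apply: (iff_trans (wd_eta_generic a (cg V oV))).
apply: iff_sym; apply: (iff_trans (wd_eta_generic a (ch V oV))).
suff -> : wd_eta @^-1` (h @^-1` V) = wd_eta @^-1` (g @^-1` V) by [].
by apply/funext => x; rewrite /preimage /=; have /= -> := gh x.
Qed.

(** The trace of a closed set on the range of the unit is dense in it. *)
Lemma closed_meets_eta (C N : set (wd_space X)) : closed C -> open N ->
  C `&` N !=set0 <-> wd_eta @^-1` C `&` wd_eta @^-1` N !=set0.
Proof.
move=> cC oN; split=> [[a [Ca Na]]|[x [Cx Nx]]]; last by exists (wd_eta x).
have [x [ax Nx]] := (wd_eta_generic a oN).1 Na.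
exists x; split=> //; apply: contrapT => nCx.
have oC : open (~` C) by exact: closed_openC.
by apply: (wd_eta_generic a oC).2 Ca; exists x.
Qed.

Lemma wd_space_well_filtered : well_filtered (wd_space X).
Proof.
move=> U F oU ffF FU; apply: contrapT => nFU.
have [_ csF _] := ffF.
have [|K FK KU|W UW mW] := exists_maximal_avoiding _ oU (F := F).
- by move=> K /csF[].
- by apply: nFU; exists K.
have [oW FW _] := mW.
pose C := ~` W; have cC : closed C by exact: open_closedC.
have [C0 CI] : irreducible C := maximal_avoiding_irreducible ffF mW.
pose A := wd_eta @^-1` C.
have meetsA O : open O -> A `&` O !=set0 <-> C `&` wd_hat O !=set0.
  move=> oO; have oN : open (wd_hat O) by exists O.
  apply: iff_sym; apply: (iff_trans (closed_meets_eta cC oN)).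
  suff -> : wd_eta @^-1` (wd_hat O) = O by [].
  by apply/seteqP; split=> x /(wd_hat_eta x oO).
have clA : closed A by apply: closed_comp => // x _; exact: wd_eta_continuous.
have irrA : irreducible A.
  split=> [|O O' oO oO' /(meetsA _ oO) CO /(meetsA _ oO') CO'].
    have [|x [Ax _]] := (closed_meets_eta cC openT).1; first by rewrite setIT.
    by exists x.
  have [||a [Ca [aO aO']]] := CI (wd_hat O) (wd_hat O') _ _ CO CO'.
  - by exists O.
  - by exists O'.
  apply/(meetsA _ (openI oO oO')); exists a; split=> //.
  exact: (wd_irreducible a).2.
have detA : wf_determined A.
  move=> Y f T0Y wfY cf; have cg := @wd_ext_continuous Y f T0Y wfY cf.
  have [y gy] := maximal_avoiding_generic ffF mW wfY cg.
  exists y => V oV; apply: (iff_trans (gy V oV)).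
  have oN : open (wd_ext T0Y wfY cf @^-1` V) by move/continuousP: cg; exact.
  apply: (iff_trans (closed_meets_eta cC oN)).
  suff -> : wd_eta @^-1` (wd_ext T0Y wfY cf @^-1` V) = f @^-1` V by [].
  by apply/funext => x; rewrite /preimage /= wd_ext_eta.
pose a := WdSpace clA irrA detA.
(* The point [a] is generic for [C]. *)
have aP N : open N -> N a <-> C `&` N !=set0.
  move=> oN; apply: (iff_trans (wd_eta_generic a oN)).
  by apply: iff_sym; exact: closed_meets_eta.
have nWa : ~ W a by move=> /(aP _ oW)[b []].
apply/nWa/UW/FU => K FK; have [-> _] := csF K FK.
move=> N [oN KN]; apply/(aP _ oN); apply: contrapT => CN; apply: (FW K FK).
by move=> b Kb; apply: contrapT => nWb; apply: CN; exists b; split=> //; exact: KN.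
Qed.

End WdSpace.

(** * Reflections from universal arrows *)

(** A full subcategory is reflective as soon as every object has a universal
    arrow [eta X] to it; the left adjoint sends [f] to the extension of
    [eta Y \oc f]. *)
Lemma universal_arrow_reflective (C : category) (P : C -> Prop)
    (R : C -> full_subcategory P) (eta : forall X : C, hom X (sval (R X)))
    (ext : forall (X : C) (Y : full_subcategory P),
       hom X (sval Y) -> hom (sval (R X)) (sval Y)) :
  (forall (X : C) (Y : full_subcategory P) (f : hom X (sval Y)),
     ext X Y f \oc eta X = f) ->
  (forall (X : C) (Y : full_subcategory P) (g h : hom (sval (R X)) (sval Y)),
     g \oc eta X = h \oc eta X -> g = h) ->
  reflective P.
Proof.
move=> extE ext_uniq.
pose Rmap (X Y : C) (f : hom X Y) : hom (R X) (R Y) := ext X (R Y) (eta Y \oc f).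
have Rmap1 X : Rmap X X (idm X) = idm (R X).
  by apply: ext_uniq; rewrite extE compm1 comp1m.
have RmapM X Y Z (g : hom Y Z) (f : hom X Y) :
    Rmap X Z (g \oc f) = Rmap Y Z g \oc Rmap X Y f.
  apply: ext_uniq; rewrite /Rmap /= extE.
  by rewrite -(@compmA C) extE [RHS](@compmA C) extE (@compmA C).
exists (Functor Rmap1 RmapM).
exists (fun X Y h => (h : hom (sval (R X)) (sval Y)) \oc eta X); split.
  move=> X Y; exists (ext X Y) => [h|f]; last exact: extE.
  by apply: ext_uniq; rewrite extE.
move=> X X' Y Y' f g h /=.
by rewrite -compmA extE !compmA.
Qed.

Theorem corollary1 : reflective (fun X : T0 => well_filtered (T0_space X)).
Proof.
pose R (X : T0) : full_subcategory (fun X : T0 => well_filtered (T0_space X)) :=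
  exist _ (exist _ (wd_space (T0_space X) : Top) wd_space_T0)
    wd_space_well_filtered.
pose eta (X : T0) : hom X (sval (R X)) :=
  mkcts (@wd_eta_continuous (T0_space X)).
have cts (X Y : T0) (f : hom X Y) :
    continuous ((f : continuousType _ _) : T0_space X -> T0_space Y).
  exact: cts_fun.
pose ext (X : T0)
    (Y : full_subcategory (fun X : T0 => well_filtered (T0_space X)))
    (f : hom X (sval Y)) : hom (sval (R X)) (sval Y) :=
  mkcts (@wd_ext_continuous _ _ _ (svalP (sval Y)) (svalP Y) (@cts X (sval Y) f)).
apply: (@universal_arrow_reflective _ _ R eta ext) => [X Y f|X Y g h gh].
  by apply/continuousEP => x; exact: wd_ext_eta.
apply/continuousEP/wd_ext_unique; [exact: svalP|exact: cts_fun|exact: cts_fun|].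
by move=> x; have /continuousEP := gh; exact.
Qed.
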